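(* Let $G$ be an ample Hausdorff groupoid, let $K$ be a field, let $c:G\to H$ be a continuous cocycle into a discrete group $H$, and let $h\in H$. Then $A_K(G)_h$ is a finite-dimensional $K$-vector space if and only if $c^{-1}(h)$ is finite. In this case, $\{1_{\{\gamma\}}\}_{\gamma\in c^{-1}(h)}$ is a basis for $A_K(G)_h$, and $\dim_K (A_K(G)_h)=|c^{-1}(h)|$.
   Context: An ample Hausdorff groupoid is a locally compact Hausdorff étale topological groupoid $G$ having a basis of compact open bisections, where a bisection is a set $U\subseteq G$ such that the range map $r$ and the source map $s$ restrict to bijections from $U$ onto $r(U)$ and $s(U)$. A cocycle is a groupoid homomorphism $c:G\to H$, i.e. $c(\gamma\eta)=c(\gamma)c(\eta)$ whenever $\gamma\eta$ is defined. The Steinberg algebra is $A_K(G)=\mathrm{span}_K\{1_U: U\subseteq G\text{ a compact open bisection}\}$ (a space of functions $G\to K$), with convolution product, determined by $1_U*1_V=1_{UV}$. The cocycle $c$ induces the $H$-grading $A_K(G)=\bigoplus_{h\in H}A_K(G)_h$, where $A_K(G)_h=\mathrm{span}_K\{1_U: U\subseteq c^{-1}(h)\text{ a compact open bisection}\}$. Here $1_S$ denotes the characteristic function of $S\subseteq G$. *)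

(* Defs.v *)
From HB Require Import structures.
From mathcomp Require Import all_boot all_algebra finmap.
From mathcomp Require Import boolp classical_sets functions cardinality.
From mathcomp Require Import topology numfun.

Set Implicit Arguments.
Unset Strict Implicit.
Unset Printing Implicit Defensive.

Import GRing.Theory.
Local Open Scope classical_set_scope.
Local Open Scope ring_scope.

(** Groupoids as sets of arrows, each unit being identified with its identity
    arrow. The product [gmul x y] is total, but its value is unspecified
    unless [src x = rng y]. *)

HB.mixin Record isGroupoid (T : Type) := {
  src : T -> T;
  rng : T -> T;
  gmul : T -> T -> T;
  ginv : T -> T;
  src_src : forall x, src (src x) = src x;
  rng_src : forall x, rng (src x) = src x;
  src_rng : forall x, src (rng x) = rng x;
  rng_rng : forall x, rng (rng x) = rng x;
  src_gmul : forall x y, src x = rng y -> src (gmul x y) = src y;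
  rng_gmul : forall x y, src x = rng y -> rng (gmul x y) = rng x;
  gmulA : forall x y z, src x = rng y -> src y = rng z ->
    gmul x (gmul y z) = gmul (gmul x y) z;
  gmul_src : forall x, gmul x (src x) = x;
  gmul_rng : forall x, gmul (rng x) x = x;
  src_ginv : forall x, src (ginv x) = rng x;
  rng_ginv : forall x, rng (ginv x) = src x;
  gmul_ginvl : forall x, gmul (ginv x) x = src x;
  gmul_ginvr : forall x, gmul x (ginv x) = rng x
}.

#[short(type="groupoidType")]
HB.structure Definition Groupoid := {T of isGroupoid T & Choice T}.

HB.mixin Record isTopologicalGroupoid T & Groupoid T & Topological T := {
  gmul_continuous :
    {within [set xy : T * T | src xy.1 = rng xy.2],
      continuous (fun xy : T * T => gmul xy.1 xy.2)};
  ginv_continuous : continuous (@ginv T)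
}.

#[short(type="topGroupoidType")]
HB.structure Definition TopologicalGroupoid :=
  {T of Groupoid T & Topological T & isTopologicalGroupoid T}.

(** [f], viewed as a map from [X] to the subspace [B] of [Y], is a local
    homeomorphism. *)
Definition local_homeo (X Y : topologicalType) (B : set Y) (f : X -> Y) :=
  (forall x, B (f x)) /\
  forall x, exists U : set X,
    [/\ open_nbhs x U,
        open (f @` U : set (subspace B)),
        {within U, continuous f} &
        exists2 g : Y -> X,
          {within f @` U, continuous g} & {in U, cancel f g}].

Section AmpleGroupoids.
Variable G : topGroupoidType.

Definition unit_space : set G := range (@src G).

Definition etale := local_homeo unit_space (@rng G) /\
                    local_homeo unit_space (@src G).

Definition bisection (U : set G) :=
  set_bij U (@rng G @` U) (@rng G) /\ set_bij U (@src G @` U) (@src G).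

Definition compact_open_bisection (U : set G) :=
  [/\ compact U, open U & bisection U].

Definition ample_hausdorff :=
  [/\ locally_compact [set: G], hausdorff_space G, etale &
      exists2 B : set (set G), B `<=` compact_open_bisection & basis B].

Definition cocycle (H : groupType) (c : G -> H) :=
  forall x y, src x = rng y -> c (gmul x y) = (c x * c y)%g.

End AmpleGroupoids.

Section LinearAlgebra.
Variables (K : fieldType) (V : lmodType K).

Definition lin_span (S : set V) : set V :=
  [set v | exists (n : nat) (a : 'I_n -> K) (w : 'I_n -> V),
    (forall i, S (w i)) /\ v = \sum_(i < n) a i *: w i].

Definition finite_dimensional (W : set V) :=
  exists2 S : set V, finite_set S & W = lin_span S.

(** The family [b], indexed by the elements of [I]. *)
Definition lin_indep (T : choiceType) (I : set T) (b : T -> V) :=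
  forall (s : seq T) (a : T -> K), uniq s -> (forall i, i \in s -> I i) ->
    \sum_(i <- s) a i *: b i = 0 -> forall i, i \in s -> a i = 0.

Definition lin_basis (W : set V) (T : choiceType) (I : set T) (b : T -> V) :=
  lin_indep I b /\ W = lin_span (b @` I).

(** The number of elements of a finite basis of [W] (0 by convention if there
    is none). *)
Definition lin_dim (W : set V) : nat :=
  xget 0%N [set n : nat | exists b : 'I_n -> V, lin_basis W [set: 'I_n] b].

End LinearAlgebra.

(** [K^o] is [K] as a vector space over itself, so that [G -> K^o] is the
    [K]-vector space of functions on [G]. *)
Definition steinberg_component (K : fieldType) (G : topGroupoidType)
    (H : groupType) (c : G -> H) (h : H) : set (G -> K^o) :=
  lin_span [set \1_U | U in [set U : set G |
          compact_open_bisection U /\ U `<=` c @^-1` [set h]]].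
Arguments steinberg_component K {G H} c h.

(* Main.v *)
Require Import Defs.
From mathcomp Require Import all_boot all_algebra finmap.
From mathcomp Require Import boolp classical_sets functions cardinality.
From mathcomp Require Import topology numfun.

(** Write [X] for the fibre of [c] over [h]. It is open, since [h] is isolated
    in a discrete group, and the component of degree [h] is the span [W] of the
    indicators of the compact open bisections contained in [X].

    If [X] is finite, it is discrete, [G] being Hausdorff. Its singletons are
    then compact open bisections ([open_set1_sub_finite],
    [compact_open_bisection1]), so their indicators belong to [W]. They span
    [W] because the indicator of a subset of [X] is the sum of the indicators
    of its points ([indic_span1]), and evaluation at points shows that they are
    independent ([lin_indep_indic1]). The dimension follows because two finite
    bases have the same number of elements ([lin_basis_leq]).

    If [W] is finite-dimensional, let [F] be a finite set of generators. A
    linear combination of indicators takes finitely many values, hence so does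
    each function in [F], and [x |-> (f x)_(f in F)] has finite range. This map
    is injective on [X]: two points at which [F] agrees are not distinguished
    by any element of [W], whereas distinct points of [X] are separated by a
    small compact open bisection ([ample_separates]). So [X] is finite
    ([finite_dim_separated]). *)

Local Open Scope classical_set_scope.
Local Open Scope ring_scope.

Import GRing.Theory.

(** * Linear spans *)

Section Span.
Context {K : fieldType} {V : lmodType K}.
Implicit Types (S T W : set V) (v w : V).

(** Adding one term at a time avoids concatenating families indexed by
    ordinals when the closure properties of a span are proved. *)
Lemma lin_span_ind S (P : V -> Prop) :
  P 0 -> (forall a w v, S w -> P v -> P (a *: w + v)) ->
  forall v, lin_span S v -> P v.
Proof.
move=> P0 PD _ [n [a [w [Sw ->]]]].
by apply: big_rec => // i v _ Pv; apply: PD.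
Qed.

Lemma lin_span0 S : lin_span S 0.
Proof.
by exists 0%N, (fun=> 0), (fun=> 0); split=> [[]|] //; rewrite big_ord0.
Qed.

Lemma lin_span_cons S a w v :
  S w -> lin_span S v -> lin_span S (a *: w + v).
Proof.
move=> Sw [n [b [u [Su ->]]]].
exists n.+1, (fun i => oapp b a (unlift ord0 i)).
exists (fun i => oapp u w (unlift ord0 i)); split.
  by move=> i; case: (unlift ord0 i).
rewrite big_ord_recl unlift_none /=; congr (_ + _).
by apply: eq_bigr => i _; rewrite liftK.
Qed.

Lemma sub_lin_span S : S `<=` lin_span S.
Proof.
by move=> v Sv; rewrite -[v]addr0 -[v]scale1r; apply/lin_span_cons/lin_span0.
Qed.

Lemma lin_spanD S v w : lin_span S v -> lin_span S w -> lin_span S (v + w).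
Proof.
move=> Sv Sw; elim/lin_span_ind: v / Sv => [|a u v Su]; first by rewrite add0r.
by rewrite -addrA; apply: lin_span_cons.
Qed.

Lemma lin_spanZ S a v : lin_span S v -> lin_span S (a *: v).
Proof.
elim/lin_span_ind: v / => [|b u v Su]; first by rewrite scaler0; exact: lin_span0.
by rewrite scalerDr scalerA; apply: lin_span_cons.
Qed.

Lemma lin_span_min S T : S `<=` lin_span T -> lin_span S `<=` lin_span T.
Proof.
move=> ST; apply: lin_span_ind => [|a w v /ST Tw Tv]; first exact: lin_span0.
exact/lin_spanD/Tv/lin_spanZ.
Qed.

Lemma lin_span_family n (b : 'I_n -> V) v :
  lin_span (range b) v -> exists a : 'I_n -> K, v = \sum_i a i *: b i.
Proof.
elim/lin_span_ind: v / => [|a _ v [i _ <-] [e ->]].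
  by exists (fun=> 0); rewrite big1 // => i _; rewrite scale0r.
exists (fun j => (if j == i then a else 0) + e j).
under [RHS]eq_bigr do rewrite scalerDl.
rewrite big_split /=; congr (_ + _).
rewrite (bigD1 i) //= eqxx big1 ?addr0 // => j /negPf ->.
by rewrite scale0r.
Qed.

End Span.

(** * Invariance of dimension *)

Section Dimension.
Context {K : fieldType} {V : lmodType K}.
Implicit Types W : set V.

Lemma lin_indep_ord {n} (b : 'I_n -> V) (a : 'I_n -> K) :
  lin_indep [set: 'I_n] b -> \sum_i a i *: b i = 0 -> forall i, a i = 0.
Proof.
by move=> bI e i; apply: (bI _ a (index_enum_uniq _)); rewrite ?mem_index_enum.
Qed.

(** Expressing each basis in terms of the other gives an [n x m] matrix and an
    [m x n] matrix whose product is the identity, by linear independence. *)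
Lemma lin_basis_leq {W n m} {b : 'I_n -> V} {b' : 'I_m -> V} :
  lin_basis W [set: 'I_n] b -> lin_basis W [set: 'I_m] b' -> (n <= m)%N.
Proof.
move=> [bI Wb] [_ Wb'].
have /choice[A bA] i : exists a : 'I_m -> K, b i = \sum_j a j *: b' j.
  by apply: lin_span_family; rewrite -Wb' Wb; apply: sub_lin_span; exists i.
have /choice[B b'B] j : exists a : 'I_n -> K, b' j = \sum_i a i *: b i.
  by apply: lin_span_family; rewrite -Wb Wb'; apply: sub_lin_span; exists j.
pose MA := \matrix_(i < n, j < m) A i j; pose MB := \matrix_(j < m, i < n) B j i.
apply: (@mulmx1_min _ _ _ MA MB); apply/matrixP => i k.
apply/eqP; rewrite -subr_eq0; apply/eqP; move: k.
apply: (lin_indep_ord b (fun k => (MA *m MB) i k - 1%:M i k) bI).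
under eq_bigr do rewrite scalerBl.
rewrite sumrB [X in _ - X](bigD1 i) //= !mxE eqxx scale1r.
rewrite [X in _ - (_ + X)]big1 ?addr0; last first.
  by move=> l /negPf li; rewrite !mxE eq_sym li scale0r.
apply/eqP; rewrite subr_eq0 [X in _ == X]bA; apply/eqP.
under [RHS]eq_bigr do rewrite b'B scaler_sumr.
rewrite exchange_big; apply: eq_bigr => l _ /=.
rewrite !mxE scaler_suml; apply: eq_bigr => j _.
by rewrite !mxE scalerA.
Qed.

Lemma lin_indep_comp {T J : choiceType} {I : set T} {b : T -> V} {g : J -> T} :
  injective g -> (forall j, I (g j)) -> lin_indep I b ->
  lin_indep [set: J] (b \o g).
Proof.
move=> gI Ig bI s a us _ e j js.
(* the coefficients [a], transported along [g] *)
pose a' t := \sum_(i <- s | g i == t) a i.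
have a'g i : i \in s -> a' (g i) = a i.
  move=> si; rewrite /a' (eq_bigl (pred1 i)) => [|l]; last by rewrite /= (inj_eq gI).
  by rewrite -big_filter filter_pred1_uniq // big_seq1.
rewrite -(a'g j js); apply: (bI (map g s)).
- by rewrite map_inj_uniq.
- by move=> _ /mapP[i _ ->].
- rewrite big_map -[RHS]e; apply: eq_big_seq => i si.
  by rewrite a'g.
- exact: map_f.
Qed.

Lemma lin_dim_card {T : choiceType} {I : set T} {b : T -> V} {W} :
  finite_set I -> lin_basis W I b -> lin_dim W = #|` fset_set I|%fset.
Proof.
move=> finI [bI Wb].
have [b' b'W] : exists b' : 'I_#|` fset_set I| -> V, lin_basis W [set: 'I__] b'.
  pose g := tnth (in_tuple (fset_set I)).
  have Ig j : I (g j) by rewrite -(fset_setK finI); apply: mem_tnth.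
  exists (b \o g); split.
    by apply: lin_indep_comp bI => //; apply/tuple_uniqP; exact: fset_uniq.
  rewrite Wb; congr lin_span; apply/seteqP; split=> [_ [x Ix <-]|_ [j _ <-]].
    have /tnthP[j xj] : x \in in_tuple (fset_set I) by rewrite in_fset_set ?inE.
    by exists j => //; rewrite /= -/g xj.
  by exists (g j).
rewrite /lin_dim; apply: xget_unique; first by exists b'.
move=> n [b'' b''W]; apply/eqP.
by rewrite eqn_leq (lin_basis_leq b''W b'W) (lin_basis_leq b'W b''W).
Qed.

End Dimension.

(** * Finite-dimensional spaces of functions with finite range *)

Section FunctionSpaces.
Context {K : fieldType} {X : choiceType}.
Implicit Types (S : set (X -> K^o)) (A : set X).

Lemma lin_span_finite_range S :
  (forall f, S f -> finite_set (range f)) ->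
  forall f, lin_span S f -> finite_set (range f).
Proof.
move=> Sfin; apply: lin_span_ind => [|a f g /Sfin ff gf].
  exact: finite_image_cst.
exact: (finite_image11 (fun y z => a *: y + z) ff gf).
Qed.

Lemma lin_span_eq_at S (x y : X) :
  (forall f, S f -> f x = f y) -> forall f, lin_span S f -> f x = f y.
Proof.
move=> Sxy; apply: lin_span_ind => // a f g /Sxy fxy gxy.
by rewrite !fctE fxy gxy.
Qed.

(** The tuple of values of the functions in the family is an injection of [A]
    into a finite product of finite sets. *)
Lemma finite_separated S A : finite_set S ->
  (forall f, S f -> finite_set (range f)) ->
  (forall x y, A x -> A y -> (forall f, S f -> f x = f y) -> x = y) ->
  finite_set A.
Proof.
move=> /finite_seqP[s ->] fin sep.
pose ev x := [seq f x | f <- s].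
have evA : finite_set (ev @` A).
  apply: (@sub_finite_set _ _ (range ev)) => [_ [x _ <-]|]; first by exists x.
  have {sep} : {in s, forall f, finite_set (range f)} by move=> f /fin.
  rewrite /ev; elim: s {fin ev} => [|f s IHs] fin; first exact: finite_image_cst.
  apply: (finite_image11 cons); first by apply: fin; rewrite mem_head.
  by apply: IHs => g gs; apply: fin; rewrite inE gs orbT.
have evI : {in A &, injective ev}.
  move=> x y /set_mem Ax /set_mem Ay /eq_in_map exy.
  by apply: sep => // f /exy.
by rewrite -(eq_finite_set (inj_card_eq evI)).
Qed.

(** Functions that agree at two points on a spanning set agree there on the
    whole span. So separation of points passes from [S] to any finite set of
    generators of its span, to which [finite_separated] applies. *)
Lemma finite_dim_separated S A :
  finite_dimensional (lin_span S) ->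
  (forall f, S f -> finite_set (range f)) ->
  (forall x y, A x -> A y -> (forall f, S f -> f x = f y) -> x = y) ->
  finite_set A.
Proof.
move=> [F finF SF] fin sep; apply: (finite_separated F) => // [f Ff|x y Ax Ay Fxy].
  by apply: (lin_span_finite_range S) => //; rewrite SF; apply: sub_lin_span.
apply: sep => // f Sf; apply: (lin_span_eq_at F) => //.
by rewrite -SF; apply: sub_lin_span.
Qed.

Lemma finite_range_indic (A : set X) : finite_set (range (\1_A : X -> K^o)).
Proof.
apply: (@sub_finite_set _ _ [set 0; 1]); last exact: finite_set2.
by move=> _ [x _ <-]; rewrite indicE; case: (x \in A); [right|left].
Qed.

Lemma lin_indep_indic1 A : lin_indep A (fun x => \1_[set x] : X -> K^o).
Proof.
move=> s a us _ e i si; move/(congr1 (@^~ i)): e; rewrite fct_sumE (bigD1_seq i) //= big1.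
  by rewrite addr0 /= !fctE indicE mem_set // [_ *: _]mulr1.
by move=> j /eqP ji; rewrite !fctE indicE memNset ?[_ *: _]mulr0 // => /esym.
Qed.

Lemma indic_span1 A (U : set X) : finite_set A -> U `<=` A ->
  lin_span ((fun x => \1_[set x] : X -> K^o) @` A) \1_U.
Proof.
move=> finA UA; have finU := sub_finite_set UA finA.
suff -> : \1_U = \sum_(x <- fset_set U) \1_[set x] :> (X -> K^o).
  rewrite big_seq; apply: big_ind => [||x xU].
  - exact: lin_span0.
  - exact: lin_spanD.
  - by apply: sub_lin_span; exists x => //; apply: UA; rewrite -(fset_setK finU).
apply/funext => y; rewrite fct_sumE indicE.
have [Uy|nUy] := pselect (U y).
  rewrite mem_set // (bigD1_seq y) /= ?in_fset_set ?inE ?fset_uniq //.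
  rewrite indicE mem_set // big1 ?addr0 // => x /eqP xy.
  by rewrite indicE memNset // => /esym.
rewrite memNset // big_seq big1 // => x; rewrite in_fset_set // => /set_mem Ux.
by rewrite indicE memNset // => yx; apply: nUy; rewrite yx.
Qed.

End FunctionSpaces.

(** * Homogeneous components of Steinberg algebras *)

Section Steinberg.
Context {G : topGroupoidType}.

(** The rest of [A] is finite, hence closed. *)
Lemma open_set1_sub_finite (A : set G) (x : G) : hausdorff_space G ->
  open A -> finite_set A -> A x -> open [set x].
Proof.
move=> hG oA finA Ax.
have -> : [set x] = A `&` ~` (A `\ x).
  apply/seteqP; split=> [_ ->|y [Ay nAy]]; first by split=> // -[_ /(_ erefl)].
  by apply: contrapT => yx; apply: nAy.
apply: openI => //; apply: closed_openC.
move/hausdorff_accessible/accessible_finite_set_closed: hG; apply.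
exact: finite_setD.
Qed.

Lemma compact_open_bisection1 (x : G) : open [set x] ->
  compact_open_bisection [set x].
Proof.
move=> ox; split=> //; first exact: compact_set1.
by split; split=> // y z /set_mem -> /set_mem ->.
Qed.

(** Refine a neighbourhood in [A] of [x] that misses [y]. *)
Lemma ample_separates (A : set G) (x y : G) : ample_hausdorff G -> open A ->
  A x -> x <> y ->
  exists U, [/\ compact_open_bisection U, U `<=` A, U x & ~ U y].
Proof.
move=> [_ /hausdorff_accessible acc _ [B Bcob [_ Bnbhs]]] oA Ax /eqP xy.
have [C [oC /set_mem Cx /set_mem nCy]] := acc _ _ xy.
have [|U [BU Ux] UAC] := Bnbhs x (A `&` C).
  by apply: open_nbhs_nbhs; split=> //; apply: openI.
by exists U; split=> //; [exact: Bcob|move=> z /UAC[]|move=> /UAC[]].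
Qed.

End Steinberg.

Theorem proposition3p3 (G : topGroupoidType) (K : fieldType) (H : groupType)
    (c : G -> H) (h : H) :
  ample_hausdorff G -> cocycle c -> continuous (c : G -> discrete_topology H) ->
  (finite_dimensional (steinberg_component K c h) <->
     finite_set (c @^-1` [set h])) /\
  (finite_set (c @^-1` [set h]) ->
     lin_basis (steinberg_component K c h) (c @^-1` [set h])
       (fun x : G => \1_[set x]) /\
     lin_dim (steinberg_component K c h) = #|` fset_set (c @^-1` [set h])|%fset).
Proof.
move=> ampleG _ ctsc; set X := c @^-1` [set h].
have oX : open X.
  by move/continuousP: ctsc; apply; exact: discrete_open.
have basisX : finite_set X ->
    lin_basis (steinberg_component K c h) X (fun x : G => \1_[set x]).
  move=> finX; split; first exact: lin_indep_indic1.
  apply/seteqP; split; apply: lin_span_min.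
    by move=> _ [U [_ UX] <-]; apply: indic_span1.
  move=> _ [x Xx <-]; apply: sub_lin_span; exists [set x] => //.
  split; last by move=> _ ->.
  by have [_ hG _ _] := ampleG; apply/compact_open_bisection1/(open_set1_sub_finite X).
split; last first.
  by move=> finX; split; [exact: basisX|exact: lin_dim_card (basisX finX)].
split=> [finW|finX]; last first.
  exists ((fun x : G => \1_[set x]) @` X); first exact: finite_image.
  by have [] := basisX finX.
apply: finite_dim_separated finW _ _ => [_ [U _ <-]|x y Xx Xy sepxy].
  exact: finite_range_indic.
apply: contrapT => xy.
have [U [cobU UX Ux nUy]] := ample_separates X x y ampleG oX Xx xy.
have /eqP := sepxy \1_U (ex_intro2 _ _ U (conj cobU UX) erefl).
by rewrite !indicE mem_set // memNset // oner_eq0.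
Qed.
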